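(* Suppose that Assumption A1 and Assumption A2 (both stated in the context) are satisfied. Let $\{(w^{(k)},\mu_k)\}_{k\ge 0}$ be the sequence generated by the Algorithm, and let $\bar\gamma$ be the constant defined in the context. Then: (i) for all $k\ge 0$, $\mu_{k+1}\le(1-\alpha_2\bar\gamma)\mu_k$ and $\mu_k\le\mu_0(1-\alpha_2\bar\gamma)^k$; (ii) the sequence $\{H_0(w^{(k)})\}_{k\ge0}$ converges to $0$ $R$-linearly; (iii) the sequence $\{w^{(k)}\}_{k\ge0}$ is a Cauchy sequence converging to a solution $w^*=(x^*,y^* )$ of the variational inequality $VI(X,F)$.
   Context: **Setting.** $\mathbb{E}$ is a finite-dimensional real vector space with inner product $\langle\cdot,\cdot\rangle$ and induced norm $\|\cdot\|$; on $\mathbb{E}\times\mathbb{E}$, $\|(a,b)\|=\sqrt{\|a\|^2+\|b\|^2}$, and linear operators carry the operator norm. $X\subset\mathbb{E}$ is a closed convex set with nonempty interior, $\Pi_X$ is the Euclidean projection onto $X$, and $F:\mathbb{E}\to\mathbb{E}$ is continuously differentiable. $VI(X,F)$: find $x\in X$ with $\langle F(x),y-x\rangle\ge 0$ for all $y\in X$. $\mathrm{D}$ denotes the Fréchet derivative. A barrier of $X$ is a function $f:\mathrm{int}(X)\to\mathbb{R}$ with $f(x_k)\to\infty$ for any sequence $\{x_k\}\subset\mathrm{int}(X)$ converging to a boundary point of $X$. A barrier $f$ is a $\vartheta$-self-concordant barrier if it is three times continuously differentiable, $\vartheta=\inf\{t\ge0: t\langle h,\nabla^2f(x)h\rangle-\langle\nabla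 f(x),h\rangle^2\ge0\ \forall x\in\mathrm{int}(X),h\in\mathbb{E}\}$ is finite, and $|\mathrm{D}^3f(x)[h,h,h]|\le2(\mathrm{D}^2f(x)[h,h])^{3/2}$ for all $x\in\mathrm{int}(X)$, $h\in\mathbb{E}$. Fix a $\vartheta$-self-concordant barrier $f$ of $X$. For $\mu>0$ and $z\in\mathbb{E}$, $p_\mu(z)\in\mathrm{int}(X)$ is the unique solution of $p_\mu(z)+\mu^2\nabla f(p_\mu(z))=z$; also $p_0(z)=\Pi_X(z)$. For $\mu\ge0$ and $w=(x,y)\in\mathbb{E}\times\mathbb{E}$: $\phi_\mu(x,y)=x-p_\mu(x-y)$, $H_\mu(x,y)=(\phi_\mu(x,y),\,F(x)-y)$, $\Psi_\mu(x,y)=\|F(x)-y\|+\|\phi_\mu(x,y)\|$, $\mathcal N(\beta,\mu)=\{(x,y):\Psi_\mu(x,y)\le\beta\mu\}$. A pair $w=(x,y)$ is called a solution of $VI(X,F)$ if $H_0(w)=0$, equivalently if $x$ solves $VI(X,F)$ and $y=F(x)$. **Algorithm.** Given $\sigma,\alpha_1,\alpha_2,\alpha_3\in(0,1)$ and sequences $\{\theta_1^{(k)}\},\{\theta_2^{(k)}\}\subset(0,1)$ with $\sigma+\sqrt2\sup_k\theta_1^{(k)}<1$. Write $w^{(k)}=(x^{(k)},y^{(k)})$. Step 0. Set $k=0$; choose $\mu_0>0$, $w^{(0)}\in\mathbb{E}\times\mathbb{E}$, $\beta>\sqrt\vartheta$ with $w^{(0)}\in\mathcal N(\beta,\mu_0)$.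 Step 1. If $H_0(w^{(k)})=0$, terminate. Else if $\Psi_{\mu_k}(w^{(k)})=0$, set $\tilde w^{(k+1)}=w^{(k)}$ and go to Step 3. Else let $\triangle\tilde w^{(k)}$ solve $-H_{\mu_k}(w^{(k)})+r_1^{(k)}=\mathrm{D}H_{\mu_k}(w^{(k)})[\triangle\tilde w^{(k)}]$, where $\|r_1^{(k)}\|\le\theta_1^{(k)}\|H_{\mu_k}(w^{(k)})\|$. Step 2. Let $\lambda_k$ be the maximum of $1,\alpha_1,\alpha_1^2,\dots$ such that $\Psi_{\mu_k}(w^{(k)}+\lambda_k\triangle\tilde w^{(k)})\le(1-\sigma\lambda_k)\Psi_{\mu_k}(w^{(k)})$. Set $\tilde w^{(k+1)}=w^{(k)}+\lambda_k\triangle\tilde w^{(k)}$. Step 3. Let $\gamma_k$ be the maximum of $1,\alpha_2,\alpha_2^2,\dots$ such that $\tilde w^{(k+1)}\in\mathcal N(\beta,(1-\gamma_k)\mu_k)$. Set $\tilde\mu_{k+1}=(1-\gamma_k)\mu_k$. Step 4. Let $\triangle\hat w^{(k)}$ solve $-H_0(w^{(k)})+r_2^{(k)}=\mathrm{D}H_{\mu_k}(w^{(k)})[\triangle\hat w^{(k)}]$, where $\|r_2^{(k)}\|\le\theta_2^{(k)}\|H_0(w^{(k)})\|$. Set $\hat w^{(k+1)}=w^{(k)}+\triangle\hat w^{(k)}$. Step 5. If $\hat w^{(k+1)}\notin\mathcal N(\beta,\tilde\mu_{k+1})$, set $\mu_{k+1}=\tilde\mu_{k+1}$, $w^{(k+1)}=\tilde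 w^{(k+1)}$, $k=k+1$, return to Step 1. Else if $H_0(\hat w^{(k+1)})=0$, terminate. Else let $\eta_k$ be the greatest of $1,\alpha_3,\alpha_3^2,\dots$ such that $\hat w^{(k+1)}\notin\mathcal N(\beta,\eta_k\alpha_3\tilde\mu_{k+1})$; set $\mu_{k+1}=\eta_k\tilde\mu_{k+1}$, $w^{(k+1)}=\hat w^{(k+1)}$, $k=k+1$, return to Step 1. It is understood that the Algorithm does not terminate finitely, so that the generated sequence is infinite. **Assumption A1.** $\mathrm{D}H_{\mu_k}(w^{(k)})$ is nonsingular and there is a constant $C$ with $\|\mathrm{D}H_{\mu_k}(w^{(k)})^{-1}\|\le C$ for all $k$. **Assumption A2.** $\|F(y)-F(x)-\mathrm{D}F(x)[y-x]\|=o(\|y-x\|)$ for all $x,y\in\mathbb{E}$. **The constant $\bar\gamma$.** By a preceding result, under Assumptions A1 and A2 there exists a constant $\bar\lambda>0$, independent of $k$, such that $\lambda_k\ge\alpha_1\bar\lambda$ and $\gamma_k\ge\alpha_2\bar\gamma$, where $\bar\gamma=\min\left\{1,\ \frac{\beta\sigma\bar\lambda}{\beta+\sqrt{\vartheta}}\right\}$. Such $\bar\lambda$ and the corresponding $\bar\gamma$ are fixed. **$R$-linear convergence** to $0$ of $\{a_k\}$: there are $c>0$, $q\in(0,1)$ with $\|a_k\|\le cq^k$ for all $k$. *)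

(* Defs.v *)
From HB Require Import structures.
From mathcomp Require Import all_boot all_order all_algebra.
From mathcomp Require Import sesquilinear.
From mathcomp Require Import all_classical all_reals all_analysis.

Set Implicit Arguments.
Unset Strict Implicit.
Unset Printing Implicit Defensive.

Import Order.TTheory GRing.Theory Num.Theory.
Import numFieldNormedType.Exports.

Local Open Scope classical_set_scope.
Local Open Scope ring_scope.

(* A Euclidean space is a [normedModType] [E] together with a positive definite
   symmetric form [dot] inducing its norm, and a finite spanning family. *)
Definition finite_dimensional (R : realType) (E : lmodType R) : Prop :=
  exists n (b : 'I_n -> E), forall x, exists c : 'I_n -> R,
    x = \sum_(i < n) c i *: b i.

Definition norm_from_dot (R : realType) (E : normedModType R)
    (dot : {dot E for idfun}) : Prop :=
  forall x : E, `|x| = Num.sqrt (dot x x).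

(* The library norm on [E * E] is the max norm; it yields the same topology,
   uniformity and differentials as the Euclidean norm [enorm]. *)
Definition enorm (R : realType) (E : normedModType R) (w : E * E) : R :=
  Num.sqrt (`|w.1| ^+ 2 + `|w.2| ^+ 2).

Definition opnorm (R : realType) (E : normedModType R) (L : E * E -> E * E) : R :=
  sup [set enorm (L v) | v in [set v | enorm v <= 1]].

(* [k] times continuously (Frechet) differentiable on the open set [U].  Since
   the domain is finite dimensional, a map into the space of linear maps on [E]
   is C^k if and only if all its evaluations are. *)
Fixpoint Ck (R : realType) (E V : normedModType R) (U : set E) (k : nat)
    (g : E -> V) : Prop :=
  match k with
  | 0 => forall x, U x -> {for x, continuous g}
  | k'.+1 => (forall x, U x -> differentiable g x) /\
             forall h : E, Ck U k' (fun x => 'd g x h)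
  end.

Section Barrier.
Context {R : realType} {E : normedModType R}.
Variables (dot : {dot E for idfun}) (X : set E) (f : E -> R).

(* Only the values of [f] on the interior of [X] are ever used. *)

Definition gradient (x : E) : E :=
  xget 0 [set g : E | forall h, 'd (f : E -> R^o) x h = dot g h].

Definition D2 (x h : E) : R :=
  'd (fun y => 'd (f : E -> R^o) y h : R^o) x h.

Definition D3 (x h : E) : R :=
  'd (fun y => 'd (fun z => 'd (f : E -> R^o) z h : R^o) y h : R^o) x h.

Definition barrier : Prop :=
  forall (u : nat -> E) (x : E), (forall k, X° (u k)) ->
    (closure X `\` X°) x -> u @ \oo --> x -> f (u k) @[k --> \oo] --> +oo.

(* <h, Hessian f(x) h> is D^2 f(x)[h,h]. *)
Definition barrier_parameters : set R :=
  [set t | 0 <= t /\ forall x h, X° x ->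
             0 <= t * D2 x h - dot (gradient x) h ^+ 2].

Definition self_concordant_barrier (vartheta : R) : Prop :=
  [/\ barrier,
      Ck X° 3 (f : E -> R^o),
      barrier_parameters !=set0 /\ vartheta = inf barrier_parameters
    & forall x h, X° x -> `|D3 x h| <= 2 * (D2 x h `^ (3 / 2))].

Definition projection (z : E) : E :=
  xget 0 [set y | X y /\ forall y', X y' -> `|z - y| <= `|z - y'|].

Definition prox (mu : R) (z : E) : E :=
  if mu == 0 then projection z
  else xget 0 [set x | X° x /\ x + mu ^+ 2 *: gradient x = z].

End Barrier.

Section Smoothing.
Context {R : realType} {E : normedModType R}.
Variables (dot : {dot E for idfun}) (X : set E) (f : E -> R) (F : E -> E).

Definition solves_VI (x : E) : Prop :=
  X x /\ forall y, X y -> 0 <= dot (F x) (y - x).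

Definition phi (mu : R) (w : E * E) : E := w.1 - prox dot X f mu (w.1 - w.2).

Definition H (mu : R) (w : E * E) : E * E := (phi mu w, F w.1 - w.2).

Definition Psi (mu : R) (w : E * E) : R := `|F w.1 - w.2| + `|phi mu w|.

Definition nbhd (beta mu : R) : set (E * E) := [set w | Psi mu w <= beta * mu].

Definition DH (mu : R) (w : E * E) : E * E -> E * E := 'd (H mu) w.

End Smoothing.

Record parameters (R : realType) := MkParams {
  sigma_ : R; alpha1_ : R; alpha2_ : R; alpha3_ : R;
  theta1_ : nat -> R; theta2_ : nat -> R;
  beta_ : R }.

Definition admissible (R : realType) (P : parameters R) : Prop :=
  [/\ 0 < sigma_ P < 1,
      [/\ 0 < alpha1_ P < 1, 0 < alpha2_ P < 1 & 0 < alpha3_ P < 1],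
      forall k, 0 < theta1_ P k < 1,
      forall k, 0 < theta2_ P k < 1
    & sigma_ P + Num.sqrt 2 * sup (range (theta1_ P)) < 1].

(* [l] is the maximum of those among 1, a, a^2, ... that satisfy [Q]. *)
Definition max_power (R : realType) (a : R) (Q : R -> Prop) (l : R) : Prop :=
  [/\ exists i : nat, l = a ^+ i, Q l & forall j : nat, Q (a ^+ j) -> a ^+ j <= l].

(* The data of an infinite run.  The tilde and hat iterates and the tilde
   smoothing parameters computed in iteration [k], usually given the index [k+1],
   are stored at index [k]. *)
Record trace (R : realType) (E : normedModType R) := MkTrace {
  w_ : nat -> E * E;
  mu_ : nat -> R;
  dw_tilde : nat -> E * E;
  lambda_ : nat -> R;
  w_tilde : nat -> E * E;
  gamma_ : nat -> R;
  mu_tilde : nat -> R;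
  dw_hat : nat -> E * E;
  w_hat : nat -> E * E;
  eta_ : nat -> R }.

Section Algorithm.
Context {R : realType} {E : normedModType R}.
Variables (dot : {dot E for idfun}) (X : set E) (f : E -> R) (F : E -> E).
Variables (vartheta : R) (P : parameters R) (T : trace E).

Local Notation H := (H dot X f F).
Local Notation Psi := (Psi dot X f F).
Local Notation N := (nbhd dot X f F (beta_ P)).
Local Notation DH := (DH dot X f F).

Definition step0 : Prop :=
  [/\ 0 < mu_ T 0, Num.sqrt vartheta < beta_ P & N (mu_ T 0) (w_ T 0)].

(* [dw_tilde T k] and [lambda_ T k] are meaningless when
   Psi_{mu_k}(w_k) = 0. *)
Definition steps12 (k : nat) : Prop :=
  (Psi (mu_ T k) (w_ T k) = 0 -> w_tilde T k = w_ T k) /\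
  (Psi (mu_ T k) (w_ T k) <> 0 ->
   [/\ exists2 r : E * E,
         enorm r <= theta1_ P k * enorm (H (mu_ T k) (w_ T k))
         & - H (mu_ T k) (w_ T k) + r = DH (mu_ T k) (w_ T k) (dw_tilde T k),
       max_power (alpha1_ P)
         (fun l => Psi (mu_ T k) (w_ T k + l *: dw_tilde T k)
                   <= (1 - sigma_ P * l) * Psi (mu_ T k) (w_ T k))
         (lambda_ T k)
     & w_tilde T k = w_ T k + lambda_ T k *: dw_tilde T k]).

Definition step3 (k : nat) : Prop :=
  max_power (alpha2_ P) (fun g => N ((1 - g) * mu_ T k) (w_tilde T k)) (gamma_ T k)
  /\ mu_tilde T k = (1 - gamma_ T k) * mu_ T k.

Definition step4 (k : nat) : Prop :=
  (exists2 r : E * E,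
     enorm r <= theta2_ P k * enorm (H 0 (w_ T k))
     & - H 0 (w_ T k) + r = DH (mu_ T k) (w_ T k) (dw_hat T k)) /\
  w_hat T k = w_ T k + dw_hat T k.

Definition step5 (k : nat) : Prop :=
  (~ N (mu_tilde T k) (w_hat T k) ->
     mu_ T k.+1 = mu_tilde T k /\ w_ T k.+1 = w_tilde T k) /\
  (N (mu_tilde T k) (w_hat T k) ->
     [/\ max_power (alpha3_ P)
           (fun e => ~ N (e * alpha3_ P * mu_tilde T k) (w_hat T k)) (eta_ T k),
         mu_ T k.+1 = eta_ T k * mu_tilde T k
       & w_ T k.+1 = w_hat T k]).

(* Neither of the two termination tests ever succeeds. *)
Definition never_terminates : Prop :=
  forall k, H 0 (w_ T k) <> 0 /\
            (N (mu_tilde T k) (w_hat T k) -> H 0 (w_hat T k) <> 0).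

Definition generated_by_algorithm : Prop :=
  [/\ admissible P, step0,
      forall k, [/\ steps12 k, step3 k, step4 k & step5 k]
    & never_terminates].

Definition assumption_A1 : Prop :=
  exists C : R, forall k, exists M : E * E -> E * E,
    [/\ cancel (DH (mu_ T k) (w_ T k)) M, cancel M (DH (mu_ T k) (w_ T k))
      & opnorm M <= C].

(* The little-o is uniform in (x, y): for fixed x it would merely restate that
   F is differentiable at x. *)
Definition assumption_A2 : Prop :=
  forall e : R, 0 < e -> exists2 d : R, 0 < d &
    forall x y : E, `|y - x| <= d ->
      `|F y - F x - 'd F x (y - x)| <= e * `|y - x|.

Definition gamma_bar (lambda_bar : R) : R :=
  Num.min 1 (beta_ P * sigma_ P * lambda_bar / (beta_ P + Num.sqrt vartheta)).

(* The step length [lambda_ T k] only exists when the line search is entered. *)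
Definition step_bounds (lambda_bar : R) : Prop :=
  [/\ 0 < lambda_bar,
      forall k, Psi (mu_ T k) (w_ T k) <> 0 -> alpha1_ P * lambda_bar <= lambda_ T k
    & forall k, alpha2_ P * gamma_bar lambda_bar <= gamma_ T k].

End Algorithm.

Definition R_linear_to_0 (R : realType) (E : normedModType R)
    (a : nat -> E * E) : Prop :=
  exists c q : R, [/\ 0 < c, 0 < q < 1 & forall k, enorm (a k) <= c * q ^+ k].

(* Main.v *)
Require Import Defs.
From HB Require Import structures.
From mathcomp Require Import all_boot all_order all_algebra.
From mathcomp Require Import sesquilinear.
From mathcomp Require Import all_classical all_reals all_analysis.
From mathcomp Require Import ring lra.
Import Order.TTheory GRing.Theory Num.Theory.
Import numFieldNormedType.Exports.
Local Open Scope classical_set_scope.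
Local Open Scope ring_scope.

Set Implicit Arguments.
Unset Strict Implicit.
Unset Printing Implicit Defensive.

(* A self-concordant barrier satisfies <grad f(p), y - p> <= vartheta for p in
   the interior and y in X, whence |p_mu(z) - p_0(z)| <= mu sqrt(vartheta).
   So an iterate in N(beta, mu_k) has |H_0(w_k)| <= (beta + sqrt vartheta)
   mu_k.  Every iteration preserves w_k in N(beta, mu_k) and shrinks mu_k by
   at least the factor 1 - gamma_k, and by A1 the steps are bounded by a
   multiple of mu_k, so the iterates form a Cauchy sequence whose limit is a
   zero of the continuous map H_0.  The point p_mu(z), without which [prox]
   would be a junk value, exists because the objective |x - z|^2 / 2 + mu^2
   f(x) has compact sublevel sets in the interior, by an affine minorant of f
   and its blow-up at the boundary. *)

(** * Euclidean spaces *)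

Section Euclidean.
Context {R : realType} {E : normedModType R} (dot : {dot E for idfun}).
Hypothesis E_norm : norm_from_dot dot.

Lemma dotC (x y : E) : dot x y = dot y x.
Proof. by rewrite (@hermitian_subproof _ _ _ _ dot) expr0 mul1r. Qed.

Lemma dotDl (x y z : E) : dot (x + y) z = dot x z + dot y z.
Proof. exact: linearDl. Qed.

Lemma dotNl (x z : E) : dot (- x) z = - dot x z.
Proof. exact: linearNl. Qed.

Lemma dotZl (a : R) (x z : E) : dot (a *: x) z = a * dot x z.
Proof. by have := linearZl_LR dot z a x. Qed.

Lemma dotDr (x y z : E) : dot z (x + y) = dot z x + dot z y.
Proof. by rewrite ![dot z _]dotC dotDl. Qed.

Lemma dotNr (x z : E) : dot z (- x) = - dot z x.
Proof. by rewrite ![dot z _]dotC dotNl. Qed.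

Lemma dotZr (a : R) (x z : E) : dot z (a *: x) = a * dot z x.
Proof. by rewrite ![dot z _]dotC dotZl. Qed.

Lemma dot0l (z : E) : dot 0 z = 0.
Proof. exact: linear0l. Qed.

Definition dotE := (dotDl, dotDr, dotNl, dotNr, dotZl, dotZr).

Lemma dot_suml (I : Type) (s : seq I) (g : I -> E) z :
  dot (\sum_(i <- s) g i) z = \sum_(i <- s) dot (g i) z.
Proof.
elim: s => [|i s IHs]; first by rewrite !big_nil dot0l.
by rewrite !big_cons dotDl IHs.
Qed.

Lemma dot_ge0 (x : E) : 0 <= dot x x.
Proof.
by have [->|/(neq0_dnorm_gt0 (s := dot))/ltW//] := eqVneq x 0; rewrite dot0l.
Qed.

Lemma dot_norm (x : E) : dot x x = `|x| ^+ 2.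
Proof. by rewrite E_norm sqr_sqrtr// dot_ge0. Qed.

Lemma dot_le_norm (x y : E) : dot x y <= `|x| * `|y|.
Proof.
have [->|x0] := eqVneq x 0; first by rewrite dot0l normr0 mul0r.
have [->|y0] := eqVneq y 0; first by rewrite dotC dot0l normr0 mulr0.
have xgt0 : 0 < `|x| by rewrite normr_gt0.
have ygt0 : 0 < `|y| by rewrite normr_gt0.
have := dot_ge0 (`|y| *: x - `|x| *: y); rewrite !dotE !dot_norm (dotC y x) => h.
have {h} : 0 <= (`|x| * `|y|) * (`|x| * `|y| - dot x y) by lra.
by rewrite pmulr_rge0 ?mulr_gt0// subr_ge0.
Qed.

Lemma norm_dot_le (x y : E) : `|dot x y| <= `|x| * `|y|.
Proof.
by rewrite ler_norml dot_le_norm andbT lerNl -dotNl (le_trans (dot_le_norm _ _))// normrN.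
Qed.

Lemma dot_inj (x y : E) : (forall h, dot x h = dot y h) -> x = y.
Proof.
move=> xy; apply/eqP; rewrite -subr_eq0 -normr_eq0 -sqrf_eq0 -dot_norm.
by rewrite dotDl dotNl xy subrr.
Qed.

(** Orthonormality is expressed through the expansion along [e]: by the first clause, [x] minus its
    expansion is orthogonal to [e]. A new vector [b] either equals its expansion, or its normalised
    residual joins [e]. *)
Lemma gram_schmidt (s : seq E) : exists e : seq E,
  (forall x u, u \in e -> dot (\sum_(v <- e) dot x v *: v) u = dot x u) /\
  (forall b, b \in s -> b = \sum_(v <- e) dot b v *: v).
Proof.
elim: s => [|b s [e [eP sP]]]; first by exists [::].
pose P x := \sum_(v <- e) dot x v *: v.
have [/eqP|r0] := eqVneq (b - P b) 0.
  rewrite subr_eq0 => /eqP bP; exists e; split=> // c.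
  by rewrite inE => /predU1P[->//|/sP].
set r := b - P b in r0; have nr0 : `|r| != 0 by rewrite normr_eq0.
pose v := `|r|^-1 *: r.
have ru u : u \in e -> dot r u = 0 by move=> ue; rewrite dotDl dotNl eP// subrr.
have vu u : u \in e -> dot v u = 0 by move=> ue; rewrite dotZl ru// mulr0.
have vv : dot v v = 1.
  by rewrite dotZl dotZr dot_norm expr2 mulKf// mulVf.
have vP x : dot (P x) v = 0.
  rewrite dot_suml big_seq big1// => u ue.
  by rewrite dotZl [dot u v]dotC vu// mulr0.
exists (v :: e); split=> [x u|c]; rewrite inE.
  move=> /predU1P[->|ue]; rewrite big_cons dotDl dotZl -/(P x).
    by rewrite vv vP mulr1 addr0.
  by rewrite vu// mulr0 add0r eP.
rewrite big_cons -/(P c) => /predU1P[->|/sP cP]; last first.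
  by rewrite [in dot c v]cP vP scale0r add0r /P -cP.
have -> : dot b v = `|r|.
  rewrite -(subrK (P b) b) dotDl vP addr0 -/r dotZr dot_norm.
  by rewrite expr2 mulKf.
by rewrite /v scalerA divff// scale1r subrK.
Qed.

Hypothesis E_fin : finite_dimensional E.

Lemma orthonormal_expansion : exists e : seq E,
  forall x, x = \sum_(u <- e) dot x u *: u.
Proof.
have [n [b bP]] := E_fin.
have [e [_ eP]] := gram_schmidt (codom b).
exists e => x; have [c ->] := bP x.
under [RHS]eq_bigr do rewrite dot_suml scaler_suml.
rewrite [RHS]exchange_big /=; apply: eq_bigr => i _.
rewrite {1}(eP (b i)) ?codom_f// scaler_sumr; apply: eq_bigr => u _.
by rewrite dotZl scalerA.
Qed.

(** Applied to the differential of [f], this makes [gradient] a true gradient instead of the default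
    value of [xget]. *)
Lemma riesz (L : {linear E -> R^o}) : exists g, forall h, L h = dot g h.
Proof.
have [e eP] := orthonormal_expansion.
exists (\sum_(u <- e) L u *: u) => h.
rewrite {1}(eP h) linear_sum dot_suml; apply: eq_bigr => u _.
by rewrite linearZ dotZl /= [dot u h]dotC mulrC.
Qed.

(** Heine-Borel: Cauchy-Schwarz confines the coefficients of points of [A] to a box, and the image
    of the box under the continuous map [G] is compact. *)
Lemma closed_bounded_compact (A : set E) (M : R) :
  closed A -> (forall x, A x -> `|x| <= M) -> compact A.
Proof.
move=> clA AM; have [e eP] := orthonormal_expansion.
pose n := size e.
pose G (c : 'rV[R]_n) : E := \sum_(i < n) c ord0 i *: e`_i.
have cG : continuous G.
  have cD : continuous (fun x : E * E => x.1 + x.2) by exact: add_continuous.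
  apply: (continuous_big cD) => i _ c.
  by apply: cvgZr_tmp; [exact: (nbhs_filter c)|exact: coord_continuous].
pose I (i : 'I_n) : set R := `[- (M * `|e`_i|), M * `|e`_i|]%classic.
pose B := [set c : 'rV[R]_n | forall i, I i (c ord0 i)].
have cB : compact B.
  by apply: rV_compact => i; exact: segment_compact.
apply: (@subclosed_compact _ _ (G @` B)) => //.
  by apply: continuous_compact => //; exact: continuous_subspaceT.
move=> x Ax; exists (\row_i dot x e`_i).
  move=> i; rewrite /I /= in_itv /= mxE -ler_norml (le_trans (norm_dot_le _ _))//.
  by rewrite ler_wpM2r// AM.
rewrite [RHS]eP (big_nth 0) big_mkord; apply: eq_bigr => i _.
by rewrite mxE.
Qed.

(** Keeps the set behind [opnorm] bounded above, so that its supremum is meaningful. *)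
Lemma linear_prod_bounded (V : normedModType R) (L : {linear (E * E)%type -> V}) :
  exists K, forall w, `|L w| <= K * `|w|.
Proof.
have [e eP] := orthonormal_expansion.
exists (\sum_(u <- e) `|u| * (`|L (u, 0)| + `|L (0, u)|)) => -[a b].
have ab : (a, b) = \sum_(u <- e) (dot a u *: (u, 0) + dot b u *: (0, u)).
  rewrite [in LHS](eP a) [in LHS](eP b).
  elim: {eP} e => [|u e IHe]; first by rewrite !big_nil.
  rewrite !big_cons -IHe; congr pair; rewrite /=.
    by rewrite scaler0 addr0.
  by rewrite scaler0 add0r.
rewrite [in L _]ab linear_sum mulr_suml.
apply: (le_trans (ler_norm_sum _ _ _)); apply: ler_sum => u _.
rewrite linearD !linearZ /= (le_trans (ler_normD _ _))// !normrZ.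
rewrite -mulrA mulrDl mulrDr lerD//.
  rewrite mulrCA mulrC ler_wpM2l// (le_trans (norm_dot_le _ _))//.
  by rewrite mulrC ler_wpM2l// prod_normE le_max lexx.
rewrite mulrCA mulrC ler_wpM2l// (le_trans (norm_dot_le _ _))//.
by rewrite mulrC ler_wpM2l// prod_normE le_max lexx orbT.
Qed.

End Euclidean.

(** * Segments and one-dimensional calculus *)

Section Lines.
Context {R : realType} {E : normedModType R}.

Lemma is_derive_line (g : E -> R^o) (p v : E) (t : R) :
  differentiable g (p + t *: v) ->
  is_derive t 1 (fun s : R => g (p + s *: v)) ('d g (p + t *: v) v).
Proof.
move=> dg; have eq_quot : (fun h : R => h^-1 *:
    (((fun s : R => g (p + s *: v)) \o shift t) (h *: (1 : R)) - g (p + t *: v)))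
  = (fun h : R => h^-1 *: ((g \o shift (p + t *: v)) (h *: v) - g (p + t *: v))).
  apply/funext => h /=; congr (_ *: (g _ - _)).
  by rewrite [h *: _]mulr1 scalerDl addrCA.
apply: DeriveDef.
  by rewrite /derivable eq_quot; exact: diff_derivable.
by rewrite /derive eq_quot -deriveE.
Qed.

Lemma MVT_is_derive (f df : R -> R) (a b : R) : a <= b ->
  (forall x, a <= x <= b -> is_derive x 1 f (df x)) ->
  exists2 c, a <= c <= b & f b - f a = df c * (b - a).
Proof.
move=> ab fdf; have [] := @MVT_segment R f df a b ab.
- by move=> x /[!in_itv]/= /andP[ax xb]; apply: fdf; rewrite !ltW.
- apply: derivable_within_continuous => x /[!in_itv]/= xab.
  by have [] := fdf x xab.
- by move=> c /[!in_itv]/= cab fab; exists c.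
Qed.

Lemma nondecreasing_is_derive (f df : R -> R) (a b : R) : a <= b ->
  (forall x, a <= x <= b -> is_derive x 1 f (df x)) ->
  (forall x, a <= x <= b -> 0 <= df x) -> f a <= f b.
Proof.
move=> ab fdf df0; have [c cab fab] := MVT_is_derive ab fdf.
by rewrite -subr_ge0 fab mulr_ge0 ?df0// subr_ge0.
Qed.

(** For [th > 0] this derivative is nonnegative exactly when [phi s ^+ 2 <= th * d], which is the
    barrier parameter inequality along a line. *)
Lemma is_derive_oppV_sub_linear (phi : R -> R) (s d th : R) :
  phi s != 0 -> is_derive s 1 phi d ->
  is_derive s 1 (fun s => - (phi s)^-1 - s / th) (d / phi s ^+ 2 - th^-1).
Proof.
move=> phi0 dphi; have dV := is_deriveV phi0.
have dl : is_derive s 1 (fun s : R => s / th) th^-1.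
  rewrite (_ : (fun s : R => s / th) = th^-1 \*: (id : R -> R)); last first.
    by apply/funext => x; exact: mulrC.
  by apply: is_derive_eq; exact: mulr1.
apply: is_derive_eq.
rewrite scaleNr opprK; congr (_ - _).
by rewrite [LHS]mulrC.
Qed.

(** The shape of the proximal objective along a line: a quadratic plus a multiple of the barrier. *)
Lemma is_derive_quadratic_add (g : R -> R) (t a b c m d : R) :
  is_derive t 1 g d ->
  is_derive t 1 (fun s => a + s * b + s ^+ 2 * c + m * g s)
    (b + 2 * t * c + m * d).
Proof.
move=> dg.
rewrite (_ : (fun s => _) = cst a + b \*: (id : R -> R) + c \*: ((id : R -> R) ^+ 2)
  + m \*: g); last first.
  by apply/funext => s; rewrite /= mulrC [_ ^+ 2 * c]mulrC exprfctE.
apply: is_derive_eq; rewrite add0r expr1.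
by congr (_ + _ + _); [exact: mulr1|rewrite [LHS]mulrC; congr (_ * _); exact: mulr1].
Qed.

Variable X : set E.
Hypothesis X_convex : convex_set (X : set (convex_lmodType E)).

Lemma convex_segment (a b : E) (t : R) :
  X a -> X b -> 0 <= t <= 1 -> X (a + t *: (b - a)).
Proof.
move=> Xa Xb /andP[t0 t1]; pose l := Itv01 t0 t1.
have := X_convex (x := b) (y := a) (l : {i01 R}); rewrite !inE => /(_ Xb Xa).
congr X; rewrite /conv /= /unstable.onem scalerBr scalerBl scale1r.
by rewrite addrCA.
Qed.

Lemma interior_segment (p y : E) (t : R) :
  X° p -> X y -> 0 <= t < 1 -> X° (p + t *: (y - p)).
Proof.
move=> /nbhs_ballP[e /= e0 pX] Xy /andP[t0 t1].
have t1' : 0 < 1 - t by rewrite subr_gt0.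
apply/nbhs_ballP; exists ((1 - t) * e) => /=; first exact: mulr_gt0.
move=> q; rewrite -ball_normE /= => qe.
(* [p - (1 - t)^-1 *: d] is the preimage of [q] under the homothety of centre [y] and ratio [1 - t];
   the radius [(1 - t) * e] keeps it in the ball around [p]. *)
pose d := p + t *: (y - p) - q.
have Xp' : X (p - (1 - t)^-1 *: d).
  apply: pX; rewrite -ball_normE /= opprB addrCA subrr addr0 normrZ.
  by rewrite ger0_norm ?invr_ge0 ?ltW// ltr_pdivrMl.
have := convex_segment Xp' Xy; move=> /(_ t); rewrite t0 ltW// => /(_ isT).
set u := _^-1 *: d; have ud : u - t *: u = d.
  by rewrite -{1}(scale1r u) -scalerBl /u scalerA divff ?scale1r// gt_eqF.
congr X; rewrite opprB addrA addrAC scalerDr addrACA -[X in _ + X]opprK opprD opprK.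
by rewrite ud /d subKr.
Qed.

End Lines.

(** * Self-concordant barriers *)

Section BarrierCalculus.
Context {R : realType} {E : normedModType R}.
Variables (dot : {dot E for idfun}) (X : set E) (f : E -> R).
Hypothesis E_norm : norm_from_dot dot.
Hypothesis E_fin : finite_dimensional E.
Hypothesis X_convex : convex_set (X : set (convex_lmodType E)).
Hypothesis f_C3 : Ck X° 3 (f : E -> R^o).

Let f_diff x : X° x -> differentiable (f : E -> R^o) x.
Proof. by case: f_C3 => + _; apply. Qed.

Let df_diff x h :
  X° x -> differentiable (fun y => 'd (f : E -> R^o) y h : R^o) x.
Proof. by case: f_C3 => _ /(_ h)[+ _]; apply. Qed.

Lemma dot_gradient x h : dot (gradient dot f x) h = 'd (f : E -> R^o) x h.
Proof.
have [g gP] := riesz E_norm E_fin ('d (f : E -> R^o) x).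
rewrite /gradient; case: xgetP => [_ -> -> //|/(_ g)].
by move=> /(_ gP).
Qed.

Lemma barrier_parameter_sqr_le (th : R) x h :
  barrier_parameters dot X f th -> X° x ->
  'd (f : E -> R^o) x h ^+ 2 <= th * D2 f x h.
Proof.
by move=> [_ thP] Xx; have := thP x h Xx; rewrite dot_gradient subr_ge0.
Qed.

(** Convexity follows from the parameter inequality: for [th > 0], [th * D2] dominates a square; for
    [th = 0], the first derivative vanishes throughout the interior, and so does its own
    derivative. *)
Lemma D2_ge0 (th : R) x h :
  barrier_parameters dot X f th -> X° x -> 0 <= D2 f x h.
Proof.
move=> thP Xx; have [th0 _] := thP.
have [th_eq0|th_neq0] := eqVneq th 0; last first.
  have th_gt0 : 0 < th by rewrite lt_neqAle eq_sym th_neq0.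
  rewrite -(pmulr_rge0 _ th_gt0).
  exact: le_trans (sqr_ge0 _) (barrier_parameter_sqr_le h thP Xx).
suff -> : D2 f x h = 0 by [].
rewrite /D2 -deriveE; last exact: df_diff.
rewrite (@near_eq_derive _ _ _ _ (cst 0)) ?derive_cst//.
apply: filterS (open_nbhs_nbhs (conj (@open_interior _ X) Xx)) => y Xy.
apply/eqP; rewrite -sqrf_eq0 eq_le sqr_ge0 andbT.
by rewrite (le_trans (barrier_parameter_sqr_le h thP Xy))// th_eq0 mul0r.
Qed.

Let is_derive_df p v t : X° (p + t *: v) ->
  is_derive t 1 (fun s : R => 'd (f : E -> R^o) (p + s *: v) v)
    (D2 f (p + t *: v) v).
Proof. by move=> Xt; apply: is_derive_line; exact: df_diff. Qed.

(* With [phi s = Df(p + s v)[v]], the barrier parameter gives [phi' >= phi^2 / th], so [1 / phi + s / th] is nonincreasing; were [phi 0 > th], it would force [1 / phi <= 0] at [s = th / phi 0 < 1]. *)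
Lemma diff_le_barrier_parameter (th : R) p y :
  barrier_parameters dot X f th -> X° p -> X y ->
  'd (f : E -> R^o) p (y - p) <= th.
Proof.
move=> thP Xp Xy; have [th0 _] := thP.
set v := y - p; pose phi s : R := 'd (f : E -> R^o) (p + s *: v) v.
have phi0E : phi 0 = 'd (f : E -> R^o) p v by rewrite /phi scale0r addr0.
rewrite -phi0E leNgt; apply/negP => th_lt.
have seg s : 0 <= s < 1 -> X° (p + s *: v) by exact: interior_segment.
have c0 : 0 < phi 0 by exact: le_lt_trans th_lt.
have [th_eq0|th_neq0] := eqVneq th 0.
  have := barrier_parameter_sqr_le v thP Xp; rewrite th_eq0 mul0r -phi0E.
  by rewrite leNgt exprn_gt0.
have th_gt0 : 0 < th by rewrite lt_neqAle eq_sym th_neq0.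
pose t := th / phi 0.
have t0 : 0 <= t by rewrite divr_ge0// ltW.
have t1 : t < 1 by rewrite ltr_pdivrMr// mul1r.
have dphi s : 0 <= s <= t -> is_derive s 1 phi (D2 f (p + s *: v) v).
  by move=> /andP[s0 st]; apply/is_derive_df/seg; rewrite s0 (le_lt_trans st).
have D2v s : 0 <= s <= t -> phi s ^+ 2 <= th * D2 f (p + s *: v) v.
  move=> /andP[s0 st]; apply: barrier_parameter_sqr_le thP _.
  by apply: seg; rewrite s0 (le_lt_trans st).
have D2p s : 0 <= s <= t -> 0 <= D2 f (p + s *: v) v.
  move=> /andP[s0 st]; apply: D2_ge0 thP _.
  by apply: seg; rewrite s0 (le_lt_trans st).
have phi_ge s : 0 <= s <= t -> phi 0 <= phi s.
  move=> /andP[s0 st]; apply: (nondecreasing_is_derive s0).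
    by move=> x /andP[x0 xs]; apply: dphi; rewrite x0 (le_trans xs).
  by move=> x /andP[x0 xs]; apply: D2p; rewrite x0 (le_trans xs).
have phi_gt0 s : 0 <= s <= t -> 0 < phi s.
  by move=> /phi_ge; exact: lt_le_trans.
pose psi s := - (phi s)^-1 - s / th.
have : psi 0 <= psi t.
  apply: (@nondecreasing_is_derive _ _
    (fun s => D2 f (p + s *: v) v / phi s ^+ 2 - th^-1)) => // s st.
    by apply: is_derive_oppV_sub_linear (dphi s st); rewrite gt_eqF// phi_gt0.
  rewrite subr_ge0 ler_pdivlMr ?exprn_gt0 ?phi_gt0//.
  by rewrite mulrC ler_pdivrMr// mulrC D2v.
have tth : t / th = (phi 0)^-1 by rewrite /t mulrAC divff// mul1r.
have : 0 < (phi t)^-1 by rewrite invr_gt0 phi_gt0// t0 lexx.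
by rewrite /psi tth mul0r; lra.
Qed.

(** The mean value theorem turns the increment into the slope at an intermediate point of the
    segment, and slopes increase along it because [D2] is nonnegative. *)
Lemma diff_lower_bound (th : R) x y :
  barrier_parameters dot X f th -> X° x -> X° y ->
  f x + 'd (f : E -> R^o) x (y - x) <= f y.
Proof.
move=> thP Xx Xy; set v := y - x.
have seg s : 0 <= s <= 1 -> X° (x + s *: v).
  move=> /andP[s0]; rewrite le_eqVlt => /predU1P[->|s1].
    by rewrite scale1r addrC subrK.
  by apply: interior_segment => //; [exact: interior_subset|rewrite s0].
have [c /andP[c0 c1] /eqP] := @MVT_is_derive R (fun s => f (x + s *: v))
  (fun s => 'd (f : E -> R^o) (x + s *: v) v) 0 1 ler01
  (fun s s01 => is_derive_line (f_diff (seg s s01))).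
rewrite scale1r scale0r addr0 [x + v]addrC subrK subr0 mulr1 subr_eq => /eqP ->.
rewrite addrC lerD2r.
pose phi s : R := 'd (f : E -> R^o) (x + s *: v) v.
have -> : 'd (f : E -> R^o) x v = phi 0 by rewrite /phi scale0r addr0.
apply: (nondecreasing_is_derive c0 (f := phi)) => s /andP[s0 sc].
  by apply: is_derive_df; apply: seg; rewrite s0 (le_trans sc).
by apply: D2_ge0 thP _; apply: seg; rewrite s0 (le_trans sc).
Qed.

End BarrierCalculus.

(** * Projection and proximal map *)

Section Projection.
Context {R : realType} {E : normedModType R}.
Variables (dot : {dot E for idfun}) (X : set E).
Hypothesis E_norm : norm_from_dot dot.
Hypothesis E_fin : finite_dimensional E.
Hypothesis X_closed : closed X.
Hypothesis X_convex : convex_set (X : set (convex_lmodType E)).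
Hypothesis X_neq0 : X !=set0.

Lemma normD_scale_sqr (a b : E) (t : R) :
  `|a + t *: b| ^+ 2 = `|a| ^+ 2 + 2 * t * dot a b + t ^+ 2 * `|b| ^+ 2.
Proof.
rewrite -!(dot_norm E_norm) !dotE [dot b a]dotC; ring.
Qed.

Lemma projection_exists z :
  exists y, X y /\ forall y', X y' -> `|z - y| <= `|z - y'|.
Proof.
have [x0 Xx0] := X_neq0.
(* Only points at least as close to [z] as [x0] compete, and they form a compact set. *)
pose K := X `&` [set x | `|z - x| <= `|z - x0|].
have cdist : continuous (fun x : E => `|z - x|).
  by move=> x; apply: cvg_norm; apply: cvgB; [exact: cvg_cst|exact: cvg_id].
have cK : compact K.
  apply: (closed_bounded_compact E_norm E_fin (M := `|z| + `|z - x0|)).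
    apply: closedI => //.
    by apply: (@closed_comp _ _ (fun x : E => `|z - x|) [set r | r <= `|z - x0|]).
  move=> x [_ /= xz]; rewrite -[x](subKr z) (le_trans (ler_normB _ _))//.
  by rewrite lerD2l.
have K0 : K !=set0 by exists x0; split=> /=.
have [y /set_mem[Xy yz] ymin] := compact_EVT_min K0 cK (continuous_subspaceT cdist).
exists y; split=> // y' Xy'; have [y'z|/ltW] := leP `|z - y'| `|z - x0|.
  by apply: ymin; rewrite inE.
exact: le_trans.
Qed.

Lemma projectionP z :
  X (projection X z) /\ forall y, X y -> `|z - projection X z| <= `|z - y|.
Proof.
rewrite /projection; have [y yP] := projection_exists z.
by case: xgetP => [_ -> //|/(_ y)].
Qed.

(** Moving from [p] by a fraction [t] towards [y] stays in [X] and changes the squared distance to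
    [z] by [t ^+ 2 * B - 2 * t * d], which is negative for small [t] if [d > 0]. *)
Lemma projection_obtuse z y :
  X y -> dot (z - projection X z) (y - projection X z) <= 0.
Proof.
have [] := projectionP z; set p := projection X z => Xp pmin Xy.
rewrite leNgt; apply/negP; set d := dot _ _ => d0.
have seg t : 0 <= t <= 1 -> 2 * t * d <= t ^+ 2 * `|y - p| ^+ 2.
  move=> t01; have := pmin _ (convex_segment X_convex Xp Xy t01).
  rewrite -[_ <= `|z - (_ + _)|](ler_pXn2r (ltn0Sn 1)) ?nnegrE//.
  by rewrite opprD addrA -scaleNr normD_scale_sqr -/d; lra.
set B := `|y - p| ^+ 2 in seg; have B0 : 0 <= B by exact: sqr_ge0.
have dB : 0 < d + B by rewrite ltr_wpDr.
(* This value of [t] lies in [(0, 1]] and satisfies [t * B <= d], which contradicts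
   [2 * t * d <= t ^+ 2 * B]. *)
have k_gt0 : 0 < d / (d + B) by rewrite divr_gt0.
have := seg (d / (d + B)); rewrite ltW// ler_pdivrMr// mul1r lerDl => /(_ B0).
have : d / (d + B) * B <= d by rewrite mulrAC ler_pdivrMr// ler_pM2l// lerDr ltW.
move: (d / (d + B)) k_gt0 => k k_gt0 kB kd.
have : k * (k * B) <= k * d by rewrite ler_pM2l.
by have : 0 < k * d by [exact: mulr_gt0]; lra.
Qed.

(** Adding the obtuse-angle inequalities at both projections gives [|p - q|^2 <= <z - z', p - q>];
    Cauchy-Schwarz then allows one factor to be cancelled. *)
Lemma projection_nonexpansive z z' :
  `|projection X z - projection X z'| <= `|z - z'|.
Proof.
have [[Xp _] [Xq _]] := (projectionP z, projectionP z').
have := projection_obtuse z Xq; have := projection_obtuse z' Xp.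
set p := projection X z; set q := projection X z' => h1 h2.
have [->|pq0] := eqVneq `|p - q| 0; first exact: normr_ge0.
have pq_gt0 : 0 < `|p - q| by rewrite lt_neqAle eq_sym pq0 normr_ge0.
rewrite -(ler_pM2r pq_gt0); apply: le_trans (dot_le_norm E_norm _ _).
rewrite -expr2 -(dot_norm E_norm); move: h1 h2; rewrite !dotE.
by rewrite (dotC dot q p); lra.
Qed.

End Projection.

Section Prox.
Context {R : realType} {E : normedModType R}.
Variables (dot : {dot E for idfun}) (X : set E) (f : E -> R) (vartheta : R).
Hypothesis E_norm : norm_from_dot dot.
Hypothesis E_fin : finite_dimensional E.
Hypothesis X_closed : closed X.
Hypothesis X_convex : convex_set (X : set (convex_lmodType E)).
Hypothesis X_int : X° !=set0.
Hypothesis f_scb : self_concordant_barrier dot X f vartheta.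

Let f_C3 : Ck X° 3 (f : E -> R^o). Proof. by case: f_scb. Qed.

Let f_diff x : X° x -> differentiable (f : E -> R^o) x.
Proof. by case: f_C3 => + _; apply. Qed.

(** * Existence of the proximal point by minimisation *)

Section Objective.
Variables (mu : R) (z x0 : E).
Hypotheses (mu0 : 0 < mu) (Xx0 : X° x0).

(** Its gradient is [x - z + mu^2 grad f(x)], so its critical points in the interior are the
    solutions of the proximal equation. *)
Let obj x := 2^-1 * `|x - z| ^+ 2 + mu ^+ 2 * f x.

Let sublevel := X° `&` [set x | obj x <= obj x0].

Let obj_cont x : X° x -> {for x, continuous obj}.
Proof.
move=> Xx; apply: cvgD; apply: cvgZl_tmp; last first.
  exact: differentiable_continuous (f_diff Xx).
rewrite expr2; apply: cvgM.
  by apply: cvg_norm; apply: cvgB; [exact: cvg_id|exact: cvg_cst].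
by apply: cvg_norm; apply: cvgB; [exact: cvg_id|exact: cvg_cst].
Qed.

(** The affine minorant of [f] at [x0] decreases at most linearly, so the quadratic term wins:
    [r = |x - z|] satisfies [r^2 <= 2 a + 2 b r]. Either [r <= 1], or dividing by [r] bounds it by
    [2 a + 2 b]. *)
Let sublevel_bounded : exists M, forall x, sublevel x -> `|x| <= M.
Proof.
have [_ _ [[th thP] _] _] := f_scb.
pose b := mu ^+ 2 * `|gradient dot f x0|; pose d := `|x0 - z|.
pose a := 2^-1 * d ^+ 2 + b * d.
exists (2 * a + 2 * b + 1 + `|z|) => x [Xx /= objx].
rewrite -[x](subrK z) (le_trans (ler_normD _ _))// lerD2r.
have := diff_lower_bound E_norm E_fin X_convex f_C3 thP Xx0 Xx.
rewrite -(dot_gradient f E_norm E_fin); set g := gradient dot f x0 in b a * => fx.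
have mu2 : 0 < mu ^+ 2 by exact: exprn_gt0.
have b0 : 0 <= b by rewrite mulr_ge0// ltW.
have d0 : 0 <= d by exact: normr_ge0.
have a0 : 0 <= a by rewrite addr_ge0// mulr_ge0// sqr_ge0.
move: objx; rewrite /obj -/d; set r := `|x - z| => objx.
have r0 : 0 <= r by exact: normr_ge0.
have gx : - (mu ^+ 2 * dot g (x - x0)) <= b * (r + d).
  rewrite -mulrN /b -mulrA ler_pM2l//.
  have := norm_dot_le E_norm g (x - x0); rewrite ler_norml lerNl => /andP[+ _].
  move=> /le_trans; apply; rewrite ler_wpM2l// /r /d [`|x0 - z|]distrC.
  exact: ler_distD.
have fx' : mu ^+ 2 * (f x0 + dot g (x - x0)) <= mu ^+ 2 * f x by rewrite ler_pM2l.
have r2 : r ^+ 2 <= 2 * a + 2 * b * r by rewrite /a; lra.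
have [r1|r1] := leP r 1; first by lra.
have : r * r <= (2 * a + 2 * b) * r by nra.
by rewrite ler_pM2r ?(lt_trans ltr01)// => /le_trans; apply; rewrite lerDl.
Qed.

(** Continuity settles limit points in the interior. At a boundary limit point, [f] would blow up
    along the sequence and push [obj] above [obj x0]. *)
Let sublevel_closed : closed sublevel.
Proof.
move=> x clx.
have /choice[u uP] (n : nat) : exists y, sublevel y /\ ball x n.+1%:R^-1 y.
  have [] := clx (ball x n.+1%:R^-1); last by move=> y [? ?]; exists y.
  by apply: nbhsx_ballx; rewrite invr_gt0.
have ux : u @ \oo --> x.
  apply/cvgrPdist_lt => _/posnumP[e]; near=> n.
  have [_] := uP n; rewrite -ball_normE => /lt_trans; apply.
  by near: n; exact: near_infty_natSinv_lt.
have Xu n : X° (u n) by have [[]] := uP n.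
have [Xx|nXx] := pselect (X° x).
  have oux : obj \o u @ \oo --> obj x by exact: (cvg_comp _ _ ux (obj_cont Xx)).
  split=> //=; apply: (cvgr_to_le oux).
  by apply: nearW => n; have [[]] := uP n.
have [f_bar _ _ _] := f_scb.
have clXx : closure X x.
  by apply: closureS clx => y [/interior_subset].
have /cvgryPgt/(_ (obj x0 / mu ^+ 2)) := f_bar u x Xu (conj clXx nXx) ux.
case=> N _ /(_ N (leqnn N)) /=; rewrite ltr_pdivrMr ?exprn_gt0// => uN.
have [[_ /=]] := uP N; rewrite /obj in uN * => + _.
by move: (sqr_ge0 `|u N - z|); lra.
Unshelve. all: by end_near. Qed.

Let obj_min : exists2 c, X° c & forall x, X° x -> obj c <= obj x.
Proof.
have [M bM] := sublevel_bounded.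
have cK := closed_bounded_compact E_norm E_fin sublevel_closed bM.
have K0 : sublevel !=set0 by exists x0; split=> /=.
have [|c /set_mem[Xc cx0] cmin] := compact_EVT_min (f := obj) K0 cK.
  by apply: continuous_in_subspaceT => x /set_mem[Xx _]; exact: obj_cont.
exists c => // x Xx; have [xx0|/ltW] := leP (obj x) (obj x0).
  by apply: cmin; rewrite inE.
exact: le_trans.
Qed.

(** The minimiser [c] of [obj] lies in an open set, so the derivative of [obj] at [c] vanishes in
    every direction [h]; this is the proximal equation tested against [h]. *)
Lemma prox_exists : exists x, X° x /\ x + mu ^+ 2 *: gradient dot f x = z.
Proof.
have [c Xc cmin] := obj_min; exists c; split=> //.
suff Dh h : dot (c - z) h + mu ^+ 2 * 'd (f : E -> R^o) c h = 0.
  apply/eqP; rewrite -subr_eq0; apply/eqP; apply: (dot_inj E_norm) => h.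
  by rewrite dot0l addrAC dotDl dotZl (dot_gradient f E_norm E_fin) Dh.
have /nbhs_ballP[e /= e0 ceX] := open_nbhs_nbhs (conj (@open_interior _ X) Xc).
have h1 : 0 < `|h| + 1 by rewrite ltr_wpDl.
(* For [|t| < d] the point [c + t *: h] stays in the ball of radius [e]; the added 1 covers
   [h = 0]. *)
pose d := e / (`|h| + 1); have d0 : 0 < d by rewrite divr_gt0.
have Xt t : t \in `]- d, d[ -> X° (c + t *: h).
  rewrite in_itv /= -ltr_norml => td; apply: ceX; rewrite -ball_normE /=.
  rewrite opprD addrA subrr sub0r normrN normrZ.
  apply: (@le_lt_trans _ _ (`|t| * (`|h| + 1))); first by rewrite ler_wpM2l// lerDl.
  by rewrite -ltr_pdivlMr.
pose G t := 2^-1 * `|c - z| ^+ 2 + t * dot (c - z) h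
  + t ^+ 2 * (2^-1 * `|h| ^+ 2) + mu ^+ 2 * f (c + t *: h).
have objG t : obj (c + t *: h) = G t.
  by rewrite /obj addrAC (normD_scale_sqr E_norm) /G; field.
have dG t : t \in `]- d, d[ -> is_derive t 1 G
    (dot (c - z) h + 2 * t * (2^-1 * `|h| ^+ 2)
     + mu ^+ 2 * 'd (f : E -> R^o) (c + t *: h) h).
  by move=> td; apply/is_derive_quadratic_add/is_derive_line/f_diff/Xt.
have dd : 0 \in `]- d, d[ by rewrite in_itv /= oppr_lt0 d0.
have dd' : - d <= d by apply: ltW; move: d0; lra.
have Gd t : t \in `]- d, d[ -> derivable G t 1 by move=> /dG[].
have Gmin t : t \in `]- d, d[ -> G 0 <= G t.
  by move=> td; rewrite -!objG scale0r addr0; apply: cmin; exact: Xt.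
have G0 := derive1_at_min dd' Gd dd Gmin.
have := @derive_val _ _ _ _ _ _ _ G0; rewrite (@derive_val _ _ _ _ _ _ _ (dG 0 dd)).
by rewrite mulr0 mul0r addr0 scale0r addr0.
Qed.

End Objective.

Lemma proxP mu z : 0 < mu ->
  X° (prox dot X f mu z) /\
  prox dot X f mu z + mu ^+ 2 *: gradient dot f (prox dot X f mu z) = z.
Proof.
move=> mu0; have [x0 Xx0] := X_int; rewrite /prox gt_eqF//.
have [x xP] := prox_exists z mu0 Xx0.
by case: xgetP => [_ -> //|/(_ x)].
Qed.

(** The bound holds with every admissible parameter, hence with their infimum [vartheta]. *)
Lemma gradient_le_barrier_parameter p y :
  X° p -> X y -> dot (gradient dot f p) (y - p) <= vartheta.
Proof.
move=> Xp Xy; have [_ _ [th_neq0 ->] _] := f_scb.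
apply: lb_le_inf => // th thP; rewrite (dot_gradient f E_norm E_fin).
exact: (diff_le_barrier_parameter E_norm E_fin X_convex f_C3 thP).
Qed.

(* Testing the obtuse-angle inequality of the projection against the prox point leaves [|p - q|^2 <= mu^2 <grad f p, q - p>]. *)
Lemma prox_projection_dist mu z : 0 < mu ->
  `|prox dot X f mu z - projection X z| <= Num.sqrt vartheta * mu.
Proof.
move=> mu0; have [] := proxP z mu0.
set p := prox _ _ _ _ _; set q := projection X z => Xp pz.
have X_neq0 : X !=set0 by exists p; exact: interior_subset.
have [Xq _] := projectionP E_norm E_fin X_closed X_neq0 z.
have := projection_obtuse E_norm E_fin X_closed X_convex X_neq0 z (interior_subset Xp).
rewrite -/q => obt; have := gradient_le_barrier_parameter Xp Xq => gle.
have {}gle : mu ^+ 2 * dot (gradient dot f p) (q - p) <= mu ^+ 2 * vartheta.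
  by rewrite ler_pM2l// exprn_gt0.
have pq2 : `|p - q| ^+ 2 <= mu ^+ 2 * vartheta.
  apply: le_trans gle; rewrite -dotZl -(dot_norm E_norm).
  have -> : mu ^+ 2 *: gradient dot f p = z - p by rewrite -{1}pz addrAC subrr add0r.
  by move: obt; rewrite !dotE (dotC dot q p); lra.
rewrite -(ger0_norm (normr_ge0 (p - q))) -sqrtr_sqr.
rewrite -[mu in leRHS](ger0_norm (ltW mu0)) -sqrtr_sqr mulrC -sqrtrM ?sqr_ge0//.
by rewrite ler_wsqrtr.
Qed.

End Prox.

(** * Sequences with geometric steps and the norm of the product *)

Section Geometric.
Context {R : realType} {V : normedModType R}.
Variables (u : nat -> V) (c q : R).
Hypotheses (q0 : 0 < q) (q1 : q < 1).
Hypothesis u_step : forall n, `|u n.+1 - u n| <= c * q ^+ n.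

Lemma geometric_step_dist n m : `|u (n + m)%N - u n| <= c / (1 - q) * q ^+ n.
Proof.
have q1' : 0 < 1 - q by rewrite subr_gt0.
have c0 : 0 <= c.
  by have := le_trans (normr_ge0 _) (u_step 0); rewrite expr0 mulr1.
(* Keeping the exact partial sum [q ^+ n - q ^+ (n + m)] gives a bound that induction on [m] can
   carry. *)
suff : (1 - q) * `|u (n + m)%N - u n| <= c * (q ^+ n - q ^+ (n + m)).
  rewrite mulrAC ler_pdivlMr// mulrC => /le_trans; apply.
  by rewrite ler_wpM2l// lerBlDr lerDl exprn_ge0// ltW.
elim: m => [|m IHm]; first by rewrite addn0 !subrr normr0 !mulr0.
have := le_trans (ler_distD (u (n + m)%N) _ _) (lerD (u_step (n + m)) (lexx _)).
rewrite addnS => h.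
have : (1 - q) * `|u (n + m).+1 - u n| <=
       (1 - q) * (c * q ^+ (n + m) + `|u (n + m)%N - u n|) by rewrite ler_pM2l.
by rewrite exprS; lra.
Qed.

Lemma geometric_step_cauchy : cauchy (u @ \oo).
Proof.
apply: cauchy_exP => _/posnumP[e].
have : (c / (1 - q)) * q ^+ n @[n --> \oo] --> (0 : R).
  by apply: cvg_geometric; rewrite ger0_norm// ltW.
move=> /cvgrPdist_lt/(_ e%:num (ltac:(by [])))[N _ NP].
exists (u N); exists N => // n /= Nn.
rewrite -ball_normE /= distrC -(subnKC Nn).
apply: le_lt_trans (geometric_step_dist _ _) _.
by have := NP N (leqnn N); rewrite /= sub0r normrN; apply: le_lt_trans; exact: ler_norm.
Qed.

Lemma geometric_step_bounded n : `|u n| <= `|u 0%N| + c / (1 - q).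
Proof.
rewrite -[u n](subrK (u 0%N)) addrC (le_trans (ler_normD _ _))// lerD2l.
by have := geometric_step_dist 0 n; rewrite expr0 mulr1.
Qed.

End Geometric.

Section ProductNorm.
Context {R : realType} {E : normedModType R}.
Implicit Type w : E * E.

Lemma enorm_le_sum w : enorm w <= `|w.1| + `|w.2|.
Proof.
rewrite /enorm -[leRHS]ger0_norm ?addr_ge0// -sqrtr_sqr ler_wsqrtr//.
by have := mulr_ge0 (normr_ge0 w.1) (normr_ge0 w.2); lra.
Qed.

Lemma norm_le_enorm w : `|w| <= enorm w.
Proof.
rewrite prod_normE ge_max; apply/andP; split.
  rewrite -[leLHS]ger0_norm// -sqrtr_sqr /enorm ler_wsqrtr// lerDl sqr_ge0//.
by rewrite -[leLHS]ger0_norm// -sqrtr_sqr /enorm ler_wsqrtr// lerDr sqr_ge0.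
Qed.

Lemma enorm_le_norm w : enorm w <= 2 * `|w|.
Proof.
rewrite (le_trans (enorm_le_sum w))// mulr_natl mulr2n.
by rewrite lerD// prod_normE le_max lexx// orbT.
Qed.

Lemma enormZ (a : R) w : enorm (a *: w) = `|a| * enorm w.
Proof.
rewrite /enorm /= !normrZ !exprMn -mulrDr sqrtrM ?sqr_ge0//.
by rewrite sqrtr_sqr normr_id.
Qed.

Variable dot : {dot E for idfun}.
Hypothesis E_norm : norm_from_dot dot.
Hypothesis E_fin : finite_dimensional E.

Lemma enorm_le_opnorm (L : {linear (E * E)%type -> (E * E)%type}) w :
  enorm (L w) <= opnorm L * enorm w.
Proof.
have [K KP] := linear_prod_bounded E_norm E_fin L.
have ub v : enorm v <= 1 -> enorm (L v) <= opnorm L.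
  move=> v1; apply: ub_le_sup; last by exists v.
  exists (2 * `|K|) => _ [x /= x1 <-].
  rewrite (le_trans (enorm_le_norm _))// ler_pM2l// (le_trans (KP x))//.
  rewrite (le_trans (ler_wpM2r _ (ler_norm K)))// -[leRHS]mulr1 ler_wpM2l//.
  exact: le_trans (norm_le_enorm _) x1.
have [w0|w0] := eqVneq (enorm w) 0.
  have /eqP := norm_le_enorm w; rewrite w0 => /eqP; rewrite normr_le0 => /eqP ->.
  by rewrite linear0 mulr0 (le_trans (enorm_le_norm _))// normr0 mulr0.
have w_gt0 : 0 < enorm w by rewrite lt_neqAle eq_sym w0 sqrtr_ge0.
have := ub ((enorm w)^-1 *: w); rewrite linearZ /= !enormZ.
rewrite !(ger0_norm (x := _^-1)) ?invr_ge0 ?(ltW w_gt0)// mulVf// => /(_ (lexx _)).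
by rewrite ler_pdivrMl// mulrC.
Qed.

Lemma enorm_inverse_le (D : {linear (E * E)%type -> (E * E)%type}) M (C : R) w :
  cancel D M -> cancel M D -> opnorm M <= C -> enorm w <= `|C| * enorm (D w).
Proof.
move=> DM MD MC; have Mlin := can2_linear DM MD.
(* A1 supplies the inverse as a bare function; as the two-sided inverse of a linear map it is
   linear, and it is packed as such to apply the [opnorm] bound. *)
pose L := HB.pack_for {linear (E * E)%type -> (E * E)%type} M
  (GRing.isLinear.Build _ _ _ _ M Mlin).
rewrite -{1}(DM w) (le_trans (enorm_le_opnorm L (D w)))//.
by rewrite ler_wpM2r ?sqrtr_ge0// (le_trans MC)// ler_norm.
Qed.

(** Completeness of [E] comes from its finite dimension: the sequence stays in a closed ball, which
    is compact. *)
Lemma cauchy_bounded_cvg (u : nat -> E) (M : R) :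
  cauchy (u @ \oo) -> (forall n, `|u n| <= M) -> cvg (u @ \oo).
Proof.
move=> cu uM; pose K := [set x : E | `|x| <= M].
have cK : compact K.
  apply: (closed_bounded_compact E_norm E_fin (M := M)) => //.
  apply: (@closed_comp _ _ (fun x : E => `|x|) [set r | r <= M]).
    by move=> x _; exact: norm_continuous.
  exact: closed_le.
have FK : (u @ \oo) K by exists 0%N => // n _; exact: uM.
exact: (compact_cauchy_cvg _ cu FK cK).
Qed.

Lemma geometric_step_cvg (u : nat -> E * E) (c q : R) : 0 < q -> q < 1 ->
  (forall n, `|u n.+1 - u n| <= c * q ^+ n) -> exists l : E * E, u @ \oo --> l.
Proof.
move=> q0 q1 u_step.
have cvgE (v : nat -> E) : (forall n, `|v n.+1 - v n| <= `|u n.+1 - u n|) ->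
    cvg (v @ \oo).
  move=> vu; have v_step n : `|v n.+1 - v n| <= c * q ^+ n.
    exact: le_trans (vu n) (u_step n).
  apply: cauchy_bounded_cvg; first exact: geometric_step_cauchy v_step.
  exact: geometric_step_bounded v_step.
have u1 : cvg ((fun n => (u n).1) @ \oo).
  by apply: cvgE => n; rewrite [leRHS]prod_normE le_max lexx.
have u2 : cvg ((fun n => (u n).2) @ \oo).
  by apply: cvgE => n; rewrite [leRHS]prod_normE le_max lexx orbT.
exists (lim ((fun n => (u n).1) @ \oo), lim ((fun n => (u n).2) @ \oo)).
rewrite (_ : u = fun n => ((u n).1, (u n).2)); first exact: cvg_pair.
by apply/funext => n; case: (u n).
Qed.

End ProductNorm.

(** * Residuals for positive [mu] and in the limit [mu = 0] *)

Section Run.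
Context {R : realType} {E : normedModType R}.
Variables (dot : {dot E for idfun}) (X : set E) (F : E -> E) (f : E -> R).
Variables (vartheta : R).
Hypothesis E_norm : norm_from_dot dot.
Hypothesis E_fin : finite_dimensional E.
Hypothesis X_closed : closed X.
Hypothesis X_convex : convex_set (X : set (convex_lmodType E)).
Hypothesis X_int : X° !=set0.
Hypothesis F_cont : continuous F.
Hypothesis f_scb : self_concordant_barrier dot X f vartheta.

Local Notation H := (H dot X f F).
Local Notation Psi := (Psi dot X f F).
Local Notation N beta := (nbhd dot X f F beta).

Let X_neq0 : X !=set0.
Proof. by have [x /interior_subset] := X_int; exists x. Qed.

Lemma enorm_H_le_Psi mu w : enorm (H mu w) <= Psi mu w.
Proof. by rewrite (le_trans (enorm_le_sum _))// addrC. Qed.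

Lemma Psi_le0_H_eq0 mu w : Psi mu w <= 0 -> H mu w = 0.
Proof.
move=> Psi0; have := le_trans (norm_le_enorm _) (le_trans (enorm_H_le_Psi mu w) Psi0).
by rewrite normr_le0 => /eqP.
Qed.

Lemma phi0E w : phi dot X f 0 w = w.1 - projection X (w.1 - w.2).
Proof. by rewrite /phi /prox eqxx. Qed.

(** Only the [phi] component depends on [mu], and it moves by at most the distance between the
    proximal point and the projection. *)
Lemma Psi0_le mu w : 0 < mu -> Psi 0 w <= Psi mu w + Num.sqrt vartheta * mu.
Proof.
move=> mu0; rewrite /Defs.Psi -addrA lerD2l phi0E /phi.
set p := prox _ _ _ _ _; rewrite -[w.1 - _](subrKA p).
rewrite (le_trans (ler_normD _ _))// lerD2l.
exact: (prox_projection_dist E_norm E_fin X_closed X_convex X_int f_scb (w.1 - w.2) mu0).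
Qed.

Lemma Psi0_continuous : continuous (Psi 0).
Proof.
move=> w; have c1 : v.1 @[v --> w] --> w.1 by exact: cvg_fst.
have c2 : v.2 @[v --> w] --> w.2 by exact: cvg_snd.
have cp : continuous (projection X).
  move=> z; apply/cvgrPdist_le => e e0.
  have /cvgrPdist_le/(_ e e0) : id @ nbhs z --> z by exact: cvg_id.
  apply: filterS => z'; apply: le_trans.
  exact: (projection_nonexpansive E_norm E_fin X_closed X_convex X_neq0).
rewrite /Defs.Psi; under eq_fun do rewrite phi0E.
apply: cvgD; apply: cvg_norm; apply: cvgB => //.
  exact: (cvg_comp _ _ c1 (@F_cont w.1)).
have c12 : v.1 - v.2 @[v --> w] --> w.1 - w.2 by exact: cvgB.
exact: (cvg_comp _ _ c12 (cp (w.1 - w.2))).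
Qed.

(** With [w = (x, y)], a zero means that [y = F(x)] and that [x] is the projection of [x - y]; the
    obtuse-angle inequality at [x] is then the variational inequality. *)
Lemma H0_eq0_solves w : H 0 w = 0 -> solves_VI dot X F w.1 /\ w.2 = F w.1.
Proof.
rewrite /Defs.H phi0E => -[/eqP + /eqP]; rewrite !subr_eq0 => /eqP pw /eqP Fw.
split=> //; have [Xp _] := projectionP E_norm E_fin X_closed X_neq0 (w.1 - w.2).
rewrite -pw in Xp; split=> // y Xy.
have := projection_obtuse E_norm E_fin X_closed X_convex X_neq0 (w.1 - w.2) Xy.
by rewrite -pw addrAC subrr add0r dotNl oppr_le0 Fw.
Qed.

End Run.

(** * The algorithm *)

Section Iteration.
Context {R : realType} {E : normedModType R}.
Variables (dot : {dot E for idfun}) (X : set E) (F : E -> E) (f : E -> R).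
Variables (vartheta : R) (P : parameters R) (T : trace E) (lambda_bar : R).
Hypothesis T_run : generated_by_algorithm dot X f F vartheta P T.

Local Notation H := (H dot X f F).
Local Notation Psi := (Psi dot X f F).
Local Notation N := (nbhd dot X f F (beta_ P)).
Local Notation DH := (DH dot X f F).
Local Notation rho := (1 - alpha2_ P * gamma_bar vartheta P lambda_bar).

Lemma max_power_le1 (a : R) (Q : R -> Prop) l :
  0 < a < 1 -> max_power a Q l -> 0 < l <= 1.
Proof.
move=> /andP[a0 a1] [[i ->] _ _].
by rewrite exprn_gt0//= exprn_ile1// ltW.
Qed.

Lemma beta_gt0 : 0 < beta_ P.
Proof. by have [_ [_ + _] _ _] := T_run; apply: le_lt_trans; exact: sqrtr_ge0. Qed.

(** [gamma_bar] lies in [(0, 1]] and [alpha2_ P] in [(0, 1)], so their product is strictly between 0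
    and 1. *)
Lemma rate_in01 : 0 < lambda_bar -> 0 < rho < 1.
Proof.
move=> lam0; have [[/andP[sig0 _] [_ /andP[a0 a1] _] _ _ _] _ _ _] := T_run.
have b0 := beta_gt0.
have g0 : 0 < gamma_bar vartheta P lambda_bar.
  rewrite /gamma_bar lt_min ltr01 divr_gt0 ?mulr_gt0//.
  by rewrite ltr_wpDr// sqrtr_ge0.
have g1 : gamma_bar vartheta P lambda_bar <= 1 by rewrite /gamma_bar ge_min lexx.
rewrite subr_gt0 ltrBlDr ltrDl mulr_gt0// andbT.
by rewrite (le_lt_trans _ a1)// ler_piMr// ltW.
Qed.

Lemma iteration_step k : 0 < mu_ T k ->
  [/\ mu_ T k.+1 <= (1 - gamma_ T k) * mu_ T k, 0 < mu_ T k.+1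
    & N (mu_ T k.+1) (w_ T k.+1)].
Proof.
move=> mu0; have [adm _ steps never] := T_run.
have [_ [_ a2 a3] _ _ _] := adm.
have [_ [gam mutE] _ [hatN hatY]] := steps k.
have /andP[g0 g1] := max_power_le1 a2 gam.
have [_ Nt _] := gam; rewrite -mutE in Nt *.
have mut_ge0 : 0 <= mu_tilde T k by rewrite mutE mulr_ge0 ?subr_ge0// ltW.
have N0 w : N 0 w -> H 0 w = 0.
  by rewrite /nbhd /= mulr0; exact: Psi_le0_H_eq0.
(* If [gamma_ T k = 1] gave [mu_tilde T k = 0], then [H 0] would vanish at [w_hat T k] or, when that
   point is rejected, at the next iterate; a termination test would succeed. *)
have mut_gt0 : 0 < mu_tilde T k.
  rewrite lt_neqAle mut_ge0 andbT; apply/eqP => mut0; rewrite -mut0 in Nt hatN hatY.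
  have [Nh|Nh] := pselect (N 0 (w_hat T k)).
    by have [_] := never k; rewrite -mut0 => /(_ Nh); apply; exact: N0.
  by have [_ wE] := hatN Nh; have [] := never k.+1; rewrite wE; case; exact: N0.
have [Nh|Nh] := pselect (N (mu_tilde T k) (w_hat T k)); last first.
  by have [-> ->] := hatN Nh.
have [eta -> ->] := hatY Nh; have /andP[e0 e1] := max_power_le1 a3 eta.
split; [by rewrite ger_pMl|exact: mulr_gt0|].
(* For [eta_ T k = 1] membership is the branch hypothesis. For [eta_ T k = alpha3_ P ^+ j.+1],
   failure of membership would make the larger power [alpha3_ P ^+ j] admissible, against
   maximality. *)
have [[[|j] eE] _ emax] := eta; first by rewrite eE expr0 mul1r.
apply: contrapT => nN; move: a3 => /andP[a30 a31].
have := emax j; rewrite -exprSr -eE => /(_ nN); rewrite leNgt eE exprS.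
by rewrite gtr_pMl ?exprn_gt0// a31.
Qed.

Lemma iterate_invariant k : 0 < mu_ T k /\ N (mu_ T k) (w_ T k).
Proof.
elim: k => [|k [mu0 _]]; first by have [_ [? _ ?] _ _] := T_run.
by have [_] := iteration_step mu0.
Qed.

Hypothesis E_norm : norm_from_dot dot.
Hypothesis E_fin : finite_dimensional E.

(** Serves both Newton-type steps. In the factor 4, one 2 comes from comparing [enorm] with the max
    norm, the other from the residual [r] being no larger than [v]. *)
Lemma newton_step_le (C theta : R) (w r d v : E * E) (mu : R) M :
  cancel (DH mu w) M -> cancel M (DH mu w) -> opnorm M <= C ->
  theta <= 1 -> enorm r <= theta * enorm v -> - v + r = DH mu w d ->
  `|d| <= 4 * `|C| * enorm v.
Proof.
move=> DM MD MC th1 rv vr.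
rewrite (le_trans (norm_le_enorm _))//.
rewrite (le_trans (enorm_inverse_le E_norm E_fin d DM MD MC))//.
rewrite -[leRHS]mulrA mulrCA ler_wpM2l// -/(DH mu w) -vr.
rewrite (le_trans (enorm_le_norm _))//.
have rv' : enorm r <= enorm v.
  by rewrite (le_trans rv)// ler_piMl// sqrtr_ge0.
have := ler_normD (- v) r; rewrite normrN.
by have := norm_le_enorm v; have := norm_le_enorm r; lra.
Qed.

Hypothesis X_closed : closed X.
Hypothesis X_convex : convex_set (X : set (convex_lmodType E)).
Hypothesis X_int : X° !=set0.
Hypothesis f_scb : self_concordant_barrier dot X f vartheta.

Local Notation K := (beta_ P + Num.sqrt vartheta).

Lemma Psi0_iterate k : Psi 0 (w_ T k) <= K * mu_ T k.
Proof.
have [mu0 Nk] := iterate_invariant k; rewrite mulrDl.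
rewrite (le_trans (Psi0_le F E_norm E_fin X_closed X_convex X_int f_scb _ mu0))//.
by rewrite lerD2r.
Qed.

(** The tilde step is driven by the residual at [mu_ T k] and the hat step by the residual at 0.
    Both are at most [K * mu_ T k], so one constant works whichever point is accepted. *)
Lemma iterate_step_le : assumption_A1 dot X f F T ->
  exists C, forall k, `|w_ T k.+1 - w_ T k| <= C * mu_ T k.
Proof.
move=> [C CP]; exists (4 * `|C| * K) => k.
have [adm _ steps _] := T_run; have [mu0 Nk] := iterate_invariant k.
have [_ [a1 _ _] th1 th2 _] := adm.
have [[tilde0 tildeN] _ [[r2 r2P d2E] hatE] [hatN hatY]] := steps k.
have [M [DM MD MC]] := CP k.
have C0 : 0 <= 4 * `|C| by rewrite mulr_ge0.
have hat_le : `|w_hat T k - w_ T k| <= 4 * `|C| * K * mu_ T k.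
  rewrite hatE addrAC subrr add0r.
  have /andP[_ /ltW t1] := th2 k.
  rewrite (le_trans (newton_step_le DM MD MC t1 r2P d2E))// -[leRHS]mulrA ler_wpM2l//.
  exact: le_trans (enorm_H_le_Psi _ _ _ _ _ _) (Psi0_iterate k).
have tilde_le : `|w_tilde T k - w_ T k| <= 4 * `|C| * K * mu_ T k.
  (* If the residual vanishes, the tilde point does not move; otherwise the line search factor is at
     most 1 and cannot lengthen the step. *)
  have [/tilde0 ->|/eqP/tildeN[[r r1P d1E] lam ->]] := eqVneq (Psi (mu_ T k) (w_ T k)) 0.
    rewrite subrr normr0 mulr_ge0 ?mulr_ge0 ?(ltW mu0)//.
    by rewrite addr_ge0 ?sqrtr_ge0 ?(ltW beta_gt0).
  have /andP[l0 l1] := max_power_le1 a1 lam.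
  have /andP[_ /ltW t1] := th1 k.
  rewrite addrAC subrr add0r normrZ gtr0_norm// (le_trans (ler_piMl _ l1))//.
  rewrite (le_trans (newton_step_le DM MD MC t1 r1P d1E))// -[leRHS]mulrA ler_wpM2l//.
  rewrite (le_trans (enorm_H_le_Psi _ _ _ _ _ _))// (le_trans Nk)//.
  by rewrite ler_wpM2r ?(ltW mu0)// lerDl sqrtr_ge0.
have [Nh|Nh] := pselect (N (mu_tilde T k) (w_hat T k)).
  by have [_ _ ->] := hatY Nh.
by have [_ ->] := hatN Nh.
Qed.

End Iteration.

(** * From geometric decay of the smoothing parameter to convergence of the iterates *)

Theorem theorem3 (R : realType) (E : normedModType R) (dot : {dot E for idfun})
    (X : set E) (F : E -> E) (f : E -> R) (vartheta : R)
    (P : parameters R) (T : trace E) (lambda_bar : R)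
    (E_fin : finite_dimensional E) (E_norm : norm_from_dot dot)
    (X_closed : closed X) (X_convex : convex_set (X : set (convex_lmodType E)))
    (X_int : X° !=set0)
    (F_C1 : Ck setT 1 F)
    (f_scb : self_concordant_barrier dot X f vartheta)
    (T_run : generated_by_algorithm dot X f F vartheta P T)
    (A1 : assumption_A1 dot X f F T)
    (A2 : assumption_A2 F)
    (T_bounds : step_bounds dot X f F vartheta P T lambda_bar) :
  let rho := 1 - alpha2_ P * gamma_bar vartheta P lambda_bar in
  [/\ forall k, mu_ T k.+1 <= rho * mu_ T k /\ mu_ T k <= mu_ T 0 * rho ^+ k,
      R_linear_to_0 (fun k => H dot X f F 0 (w_ T k))
    & cauchy (w_ T @ \oo) /\
      exists ws : E * E,
        [/\ w_ T @ \oo --> ws, H dot X f F 0 ws = 0,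
            solves_VI dot X F ws.1 & ws.2 = F ws.1]].
Proof.
move=> rho; have [lam0 _ gam] := T_bounds.
have /andP[rho0 rho1] : 0 < rho < 1 := rate_in01 T_run lam0.
have inv := iterate_invariant T_run.
have mu_step k : mu_ T k.+1 <= rho * mu_ T k.
  have [mu0 _] := inv k; have [+ _ _] := iteration_step T_run mu0.
  by move=> /le_trans; apply; rewrite ler_pM2r// lerD2l lerN2.
have mu_le k : mu_ T k <= mu_ T 0 * rho ^+ k.
  elim: k => [|k IHk]; first by rewrite expr0 mulr1.
  rewrite (le_trans (mu_step k))// exprS mulrCA ler_pM2l//.
have Psi0_le k : Psi dot X f F 0 (w_ T k)
    <= (beta_ P + Num.sqrt vartheta) * mu_ T 0 * rho ^+ k.
  rewrite (le_trans (Psi0_iterate T_run E_norm E_fin X_closed X_convex X_int f_scb k))//.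
  rewrite -mulrA ler_wpM2l// addr_ge0 ?sqrtr_ge0// ltW//; exact: beta_gt0 T_run.
have c0 : 0 < (beta_ P + Num.sqrt vartheta) * mu_ T 0.
  rewrite mulr_gt0//; last by have [] := inv 0.
  by rewrite ltr_wpDr ?sqrtr_ge0//; exact: beta_gt0 T_run.
have [C C_step] := iterate_step_le T_run E_norm E_fin X_closed X_convex X_int f_scb A1.
have w_step k : `|w_ T k.+1 - w_ T k| <= `|C| * mu_ T 0 * rho ^+ k.
  rewrite (le_trans (C_step k))// (le_trans (ler_wpM2r _ (ler_norm C)))//.
    by have [/ltW] := inv k.
  by rewrite -mulrA ler_wpM2l.
split=> //.
  exists ((beta_ P + Num.sqrt vartheta) * mu_ T 0), rho; split=> // [|k].
    by rewrite rho0.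
  exact: le_trans (enorm_H_le_Psi _ _ _ _ _ _) (Psi0_le k).
split; first exact: geometric_step_cauchy rho0 rho1 w_step.
have [ws wP] := geometric_step_cvg E_norm E_fin rho0 rho1 w_step.
have F_cont : continuous F.
  by move=> x; apply: differentiable_continuous; have [+ _] := F_C1; exact.
have cPsi := Psi0_continuous E_norm E_fin X_closed X_convex X_int F_cont (f := f).
(* [Psi] at 0 along the iterates converges to its value at [ws] and is dominated by a geometric
   sequence tending to 0. *)
have Hws : H dot X f F 0 ws = 0.
  apply: Psi_le0_H_eq0.
  have rho_norm : `|rho| < 1 by rewrite gtr0_norm.
  have PsiT : Psi dot X f F 0 \o w_ T @ \oo --> Psi dot X f F 0 ws.
    exact: (cvg_comp _ _ wP (cPsi ws)).
  have geo := cvg_geometric ((beta_ P + Num.sqrt vartheta) * mu_ T 0) rho_norm.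
  by apply: (ler_cvg_to PsiT geo); apply: nearW => k; exact: Psi0_le.
have [VI wsF] := H0_eq0_solves E_norm E_fin X_closed X_convex X_int Hws.
by exists ws.
Qed.
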